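(* Let $\alpha>0$ and let $(u,m)$ be a solution of the planning problem (P$_\alpha$) with data $d,T,V,\alpha,m_0,m_T$. (i) Suppose that $p>0$ is such that $$\Vert \Delta V\Vert_{L^\infty([0,T]\times\mathbb{T}^d)}<\frac{2}{T^2}\,\frac1p .$$ Then there exists a positive constant $C$, depending only on the problem data $(d,T,V,\alpha,m_0,m_T)$ and on $p$ (and not on the particular solution $(u,m)$), such that $$\max_{t\in[0,T]}\Vert m(t,\cdot)\Vert_{L^{\infty}(\mathbb{T}^d)}\le C .$$ (ii) Suppose that $d=1$, that $p\ge2$ and $p>\alpha+1$ are such that $$\Vert \Delta V\Vert_{L^\infty([0,T]\times\mathbb{T})}<\frac{2}{T^2}\,\frac1p ,$$ and that there is a constant $k_0>0$ with $m_0(x)\ge k_0$ and $m_T(x)\ge k_0$ for all $x\in\mathbb{T}$. Then there exists a positive constant $C$, depending only on the problem data and on $p$, such that $$\max_{t\in[0,T]}\Vert m^{-1}(t,\cdot)\Vert_{L^{\infty}(\mathbb{T})}\le C .$$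
   Context: Let $d\ge1$ be an integer, $T>0$, and let $\mathbb{T}^d$ be the $d$-dimensional flat torus (unit cell, total measure $1$), with $\mathbb{T}=\mathbb{T}^1$. $D$, $\operatorname{div}$ and $\Delta$ denote the gradient, divergence and Laplacian in the space variable $x$ only. $m^{-1}$ denotes the pointwise reciprocal $1/m$. Planning problem (P$_\alpha$). The data are: an exponent $\alpha>0$; a potential $V\in C^\infty([0,T]\times\mathbb{T}^d)$; and probability densities $m_0,m_T\in C^\infty(\mathbb{T}^d)$ (non-negative, with integral $1$). A solution is a pair $(u,m)\in C^\infty([0,T]\times\mathbb{T}^d)\times C^\infty([0,T]\times\mathbb{T}^d)$ with $m\ge0$ and $$\begin{cases}-u_t+\dfrac{|Du|^2}{2}+V(t,x)=m^\alpha & \text{in }(0,T)\times\mathbb{T}^d,\\[2pt] m_t-\operatorname{div}(m\,Du)=0 & \text{in }(0,T)\times\mathbb{T}^d,\\[2pt] m(0,x)=m_0(x),\quad m(T,x)=m_T(x) & \text{in }\mathbb{T}^d.\end{cases}$$ *)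

(* Defs.v *)
From HB Require Import structures.
From mathcomp Require Import all_boot all_order all_algebra.
From mathcomp Require Import all_classical all_reals all_analysis.

Set Implicit Arguments.
Unset Strict Implicit.
Unset Printing Implicit Defensive.

Import Order.TTheory GRing.Theory Num.Theory.
Import numFieldNormedType.Exports.

Local Open Scope classical_set_scope.
Local Open Scope ring_scope.

(* Functions on the torus T^d = R^d / Z^d are Z^d-periodic functions on
   'rV[R]_d. *)
Section Smoothness.
Context {R : realType}.

(* All iterated directional derivatives exist and are Frechet differentiable
   (hence continuous). *)
Definition smooth (U : normedModType R) (f : U -> R) : Prop :=
  forall (vs : seq U) (x : U),
    differentiable (foldr (fun v (h : U -> R) => 'D_v h) f vs) x.

Definition periodic (d : nat) (f : 'rV[R]_d -> R) : Prop :=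
  forall (x : 'rV[R]_d) (i : 'I_d), f (x + delta_mx 0 i) = f x.

Definition smooth_torus (d : nat) (f : 'rV[R]_d -> R) : Prop :=
  smooth f /\ periodic f.

(* C^oo([0,T] x T^d), as the restrictions to [0,T] of the C^oo functions on
   R x T^d; the values of f outside [0,T] are irrelevant. *)
Definition smooth_cylinder (d : nat) (T : R) (f : R -> 'rV[R]_d -> R) : Prop :=
  exists g : R -> 'rV[R]_d -> R,
    [/\ smooth (fun z : R * 'rV[R]_d => g z.1 z.2),
        forall t, periodic (g t)
      & forall t x, 0 <= t <= T -> f t x = g t x].

End Smoothness.

Section SpaceDerivatives.
Context {R : realType} {d : nat}.

Definition grad (f : 'rV[R]_d -> R) (x : 'rV[R]_d) : 'rV[R]_d :=
  \row_(i < d) 'D_(delta_mx 0 i) f x.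

Definition divergence (F : 'rV[R]_d -> 'rV[R]_d) (x : 'rV[R]_d) : R :=
  \sum_(i < d) 'D_(delta_mx 0 i) (fun y => F y 0 i) x.

Definition laplacian (f : 'rV[R]_d -> R) : 'rV[R]_d -> R :=
  divergence (grad f).

(* Square of the Euclidean norm; the library norm of 'rV[R]_d is the sup
   norm. *)
Definition sqnorm (v : 'rV[R]_d) : R := \sum_(i < d) v 0 i ^+ 2.

End SpaceDerivatives.

Section TorusMeasure.
Context {R : realType}.

Definition unit_interval_measure : set (measurableTypeR R) -> \bar R :=
  mrestr (@lebesgue_measure R) (measurable_itv `[0, 1]).

HB.instance Definition _ := Measure.on unit_interval_measure.

Let unit_interval_measureT : unit_interval_measure setT = 1%E.
Proof.
rewrite /unit_interval_measure /mrestr setTI lebesgue_measure_itv/= lte_fin.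
by rewrite ltr01 oppr0 adde0.
Qed.

HB.instance Definition _ := Measure_isProbability.Build _ _ _
  unit_interval_measure unit_interval_measureT.

Definition tcons (n : nat) (z : measurableTypeR R * n.-tuple (measurableTypeR R)) :
  n.+1.-tuple (measurableTypeR R) := [the n.+1.-tuple _ of z.1 :: z.2].

Let measurable_tcons n : measurable_fun setT (@tcons n).
Proof. exact: measurable_cons. Qed.

HB.instance Definition _ n := isMeasurableFun.Build _ _ _ _ (@tcons n)
  (@measurable_tcons n).

(* Normalised Lebesgue measure of T^d, carried by the unit cell [0,1]^d. *)
Fixpoint torus_measure (d : nat) :
    probability (d.-tuple (measurableTypeR R)) R :=
  match d with
  | 0 => dirac [tuple]
  | n.+1 => distribution
      (unit_interval_measure \x torus_measure n)%E (@tcons n)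
  end.

Definition time_measure (T : R) : set (measurableTypeR R) -> \bar R :=
  mrestr (@lebesgue_measure R) (measurable_itv `[0, T]).

HB.instance Definition _ T := Measure.on (time_measure T).

Definition row_of_tuple (d : nat) (x : d.-tuple (measurableTypeR R)) :
  'rV[R]_d := \row_(i < d) tnth x i.

Definition integral_torus (d : nat) (f : 'rV[R]_d -> R) : \bar R :=
  (\int[torus_measure d]_x (f (row_of_tuple x))%:E)%E.

(* f is extended-valued so that the reciprocal of 0 counts as +oo, and not as
   0 as in the field R. *)
Definition Linfty_torus (d : nat) (f : 'rV[R]_d -> \bar R) : \bar R :=
  'N[torus_measure d]_+oo[(fun x => f (row_of_tuple x))]%E.

Definition Linfty_cylinder (d : nat) (T : R) (f : R -> 'rV[R]_d -> \bar R) :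
  \bar R :=
  'N[time_measure T \x torus_measure d]_+oo[
    (fun z => f z.1 (row_of_tuple z.2))]%E.

End TorusMeasure.

Section Planning.
Context {R : realType} {d : nat}.

Definition prob_density (f : 'rV[R]_d -> R) : Prop :=
  (forall x, 0 <= f x) /\ integral_torus f = 1%E.

Record planning_data (T alpha : R) (V : R -> 'rV[R]_d -> R)
    (m0 mT : 'rV[R]_d -> R) : Prop := PlanningData {
  pd_T_gt0 : 0 < T ;
  pd_alpha_gt0 : 0 < alpha ;
  pd_V_smooth : smooth_cylinder T V ;
  pd_m0_smooth : smooth_torus m0 ;
  pd_mT_smooth : smooth_torus mT ;
  pd_m0_density : prob_density m0 ;
  pd_mT_density : prob_density mT }.

Record planning_solution (T alpha : R) (V : R -> 'rV[R]_d -> R)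
    (m0 mT : 'rV[R]_d -> R) (u m : R -> 'rV[R]_d -> R) : Prop :=
  PlanningSolution {
  ps_u_smooth : smooth_cylinder T u ;
  ps_m_smooth : smooth_cylinder T m ;
  ps_m_ge0 : forall t x, 0 <= t <= T -> 0 <= m t x ;
  ps_hamilton_jacobi : forall t x, 0 < t < T ->
    - derive1 (fun s => u s x) t + sqnorm (grad (u t) x) / 2 + V t x
    = m t x `^ alpha ;
  ps_continuity : forall t x, 0 < t < T ->
    derive1 (fun s => m s x) t
    - divergence (fun y => m t y *: grad (u t) y) x = 0 ;
  ps_initial : forall x, m 0 x = m0 x ;
  ps_terminal : forall x, m T x = mT x }.

End Planning.

(* Main.v *)
Require Import Defs.
From HB Require Import structures.
From mathcomp Require Import all_boot all_order all_algebra.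
From mathcomp Require Import all_classical all_reals all_analysis.
From mathcomp Require Import ess_sup_inf ring lra.

(* Both bounds come from a maximum principle.  Along the direction
   [v = (1, - Du)] (frozen at a point) the continuity equation reads
   [D_v m = m Lap u]; where [Dm = 0] one more differentiation gives
   [D_v D_v m = D_v m Lap u + m Lap (D_v u)], while the Laplacian of the
   Hamilton-Jacobi equation gives
   [Lap (m ^ alpha) = - Lap (D_v u) + |D^2 u|^2 + Lap V].

   (i) If [K > sup |Lap V|], then [m exp (K t^2 / 2)] has no interior maximum at
   a point where [m > 0], so [m] is controlled by [m0] and [mT].

   (ii) In dimension one [|D^2 u|^2 = (Lap u)^2], and at an interior minimum of
   [m phi], [phi = 1 + t (T - t) / T^2], one finds
   [V_xx >= - phi'' / phi >= 8 / (5 T^2)]; but [V_xx < 2 / (p T^2) <= 1 / T^2].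
   That [m > 0] follows from the transport equation, by looking at the minimum of
   [m exp (K t) + eps t] with [K >= sup |Lap u|]. *)

Set Implicit Arguments.
Unset Strict Implicit.
Unset Printing Implicit Defensive.

Import Order.TTheory GRing.Theory Num.Theory.
Import numFieldNormedType.Exports.

Local Open Scope classical_set_scope.
Local Open Scope ring_scope.

(** * Smooth functions, their restrictions to lines, and the second derivative test *)

Lemma smooth_differentiable (R : realType) (U : normedModType R) (f : U -> R) x :
  smooth f -> differentiable f x.
Proof. by move=> sf; exact: (sf [::]). Qed.

Lemma smooth_derivable (R : realType) (U : normedModType R) (f : U -> R) x v :
  smooth f -> derivable f x v.
Proof. by move=> sf; exact/diff_derivable/smooth_differentiable. Qed.

Lemma smooth_is_derive (R : realType) (U : normedModType R) (f : U -> R) x v :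
  smooth f -> is_derive x v f ('D_v f x).
Proof. by move=> sf; exact/derivableP/smooth_derivable. Qed.

Lemma smooth_continuous (R : realType) (U : normedModType R) (f : U -> R) :
  smooth f -> continuous f.
Proof. by move=> sf x; exact/differentiable_continuous/smooth_differentiable. Qed.

Lemma smooth_derive (R : realType) (U : normedModType R) (f : U -> R) v :
  smooth f -> smooth ('D_v f).
Proof. by move=> sf vs x; have := sf (rcons vs v) x; rewrite foldr_rcons. Qed.

(* Sealing the directional derivative keeps unification from unfolding it to a
   limit. *)
HB.lock Definition dder (R : realType) (U : normedModType R) (v : U)
  (f : U -> R) : U -> R := 'D_v f.

Lemma dderE (R : realType) (U : normedModType R) (v : U) (f : U -> R) x :
  'D_v f x = dder v f x.
Proof. by rewrite dder.unlock. Qed.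

Lemma smooth_dder (R : realType) (U : normedModType R) (v : U) (f : U -> R) :
  smooth f -> smooth (dder v f).
Proof. by rewrite dder.unlock; exact: smooth_derive. Qed.

Lemma smooth_is_dder (R : realType) (U : normedModType R) (f : U -> R) x v :
  smooth f -> is_derive x v f (dder v f x).
Proof. by rewrite dder.unlock; exact: smooth_is_derive. Qed.

Lemma dder_val (R : realType) (U : normedModType R) (f : U -> R) x v df :
  is_derive x v f df -> dder v f x = df.
Proof. by rewrite dder.unlock => -[]. Qed.

Lemma is_derive_line (R : realType) (U : normedModType R) (f : U -> R)
    (z v : U) (h : R) :
  derivable f (z + h *: v) v ->
  is_derive h 1 (fun s : R => f (z + s *: v)) ('D_v f (z + h *: v)).
Proof.
have E : (fun k : R => k^-1 *: (((fun s => f (z + s *: v)) \o shift h) (k *: 1)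
      - f (z + h *: v))) =
    (fun k => k^-1 *: ((f \o shift (z + h *: v)) (k *: v) - f (z + h *: v))).
  apply/funext => k /=; congr (_ *: (f _ - _)).
  by rewrite [k *: 1]mulr1 scalerDl addrCA addrA.
by move=> df; split; rewrite /derivable /derive E.
Qed.

Lemma is_derive_line0 (R : realType) (U : normedModType R) (f : U -> R)
    (z v : U) :
  derivable f z v -> is_derive (0 : R) 1 (fun s : R => f (z + s *: v)) ('D_v f z).
Proof.
have E : z = z + (0 : R) *: v by rewrite scale0r addr0.
by move=> df; rewrite {2}E; apply: is_derive_line; rewrite -E.
Qed.

(** If [g2] were positive, [g1], which vanishes at [0], would be positive just to the right of [0],
    and the mean value theorem would push [g] above [g 0]. *)
Lemma second_derivative_at_max (R : realType) (g g1 : R -> R) (g2 e : R) :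
  0 < e -> (forall h : R, `|h| < e -> is_derive h 1 g (g1 h)) ->
  is_derive (0 : R) 1 g1 g2 -> (forall h, `|h| < e -> g h <= g 0) ->
  g1 0 = 0 /\ g2 <= 0.
Proof.
move=> e0 dg dg1 gmax.
have N0 : `|0 : R| < e by rewrite normr0.
have inE h : h \in `](- e), e[%R -> `|h| < e.
  by rewrite in_itv/= => ?; rewrite ltr_norml.
have g10 : g1 0 = 0.
  have D0 : is_derive (0 : R) 1 g 0.
    apply: (@derive1_at_max _ _ (- e) e) => [|t /inE/dg[]//||t /inE/gmax//].
      by lra.
    by rewrite in_itv/=; lra.
  by have := dg _ N0 => -[_ <-]; case: D0.
split=> //; rewrite leNgt; apply/negP => g2p.
have [cg1 Eg2] := dg1.
have : \forall h \near (0 : R)^', 0 < h^-1 *: (g1 (h *: 1 + 0) - g1 0).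
  apply: cvgr_gt g2p; rewrite -Eg2; exact: cg1.
case=> a /= a0 aP.
(* Halving both radii keeps the closed interval [[0, b]] inside the region where [g1] is positive
   and inside the one where [g] is differentiable and at most [g 0]. *)
pose b := Num.min (a / 2) (e / 2).
have b0 : 0 < b by rewrite lt_min; apply/andP; split; lra.
have bae : b < a /\ b < e.
  by split; [rewrite gt_min|rewrite gt_min]; apply/orP; [left|right]; lra.
have dgb x : x \in `[0, b]%R -> is_derive x 1 g (g1 x).
  rewrite in_itv/= => ?; apply: dg; rewrite ger0_norm; lra.
have cgb : {within `[0, b], continuous g}.
  by apply: derivable_within_continuous => x /dgb[].
have [c cb Eg] := MVT b0 (fun x xb => dgb x (subset_itv_oo_cc xb)) cgb.
move: cb; rewrite in_itv/= => cb.
have := aP c; rewrite /ball_ /= sub0r normrN g10 subr0 addr0 [c *: 1]mulr1.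
rewrite gtr0_norm; last by lra.
move=> /(_ _ _); have -> : c < a by lra.
have cn0 : c != 0 by rewrite gt_eqF//; lra.
move=> /(_ isT cn0); rewrite pmulr_rgt0 ?invr_gt0; last by lra.
move=> g1c; have : g b <= g 0 by apply: gmax; rewrite gtr0_norm; lra.
by move: Eg; rewrite subr0 => Eg; have := mulr_gt0 g1c b0; lra.

Qed.

(** * Symmetry of mixed directional derivatives *)

Lemma near_parallelogram (R : realType) (U : normedModType R) (x v w : U)
    (P : set U) : nbhs x P ->
  exists2 h : R, 0 < h &
    forall s r, 0 < s < h -> 0 < r < h -> P (x + s *: v + r *: w).
Proof.
move=> xP.
have : (fun z : R * R => x + z.1 *: v + z.2 *: w) @ (nbhs (0 : R * R)) --> x.
  have -> : nbhs x = nbhs (x + (0 : R) *: v + (0 : R) *: w).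
    by rewrite !scale0r !addr0.
  apply: cvgD; first apply: cvgD; first exact: cvg_cst.
    by apply: cvgZ; [exact: cvg_fst|exact: cvg_cst].
  by apply: cvgZ; [exact: cvg_snd|exact: cvg_cst].
move=> /(_ _ xP) /nbhs_ballP[h /= h0 hP]; exists h => // s r sh rh.
apply: (hP (s, r)); split => /=; rewrite /ball/= sub0r normrN gtr0_norm; lra.
Qed.

(** Two applications of the mean value theorem: first to the increment of [f] in the direction [w]
    as a function of the [v]-coordinate [s], then to ['D_v f] along [w]. *)
Lemma second_difference (R : realType) (U : normedModType R) (f : U -> R)
    (x v w : U) (h : R) : smooth f -> 0 < h ->
  exists s r, [/\ 0 < s < h, 0 < r < h &
   f (x + h *: v + h *: w) - f (x + h *: v) - f (x + h *: w) + f x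
   = 'D_w ('D_v f) (x + s *: v + r *: w) * h ^+ 2].
Proof.
move=> sf h0.
have dv z s : is_derive s (1 : R) (fun s => f (z + s *: v)) ('D_v f (z + s *: v)).
  by apply: is_derive_line; exact: smooth_derivable.
have dk s : is_derive s (1 : R)
    ((fun s => f (x + h *: w + s *: v)) - (fun s => f (x + s *: v)))
    ('D_v f (x + h *: w + s *: v) - 'D_v f (x + s *: v)).
  by apply: is_deriveB; exact: dv.
have ck : {within `[0, h], continuous
    ((fun s => f (x + h *: w + s *: v)) - (fun s => f (x + s *: v)))}.
  by apply: derivable_within_continuous => s _; case: (dk s).
have [s] := MVT h0 (fun s _ => dk s) ck.
rewrite in_itv/= => s0h Es.
have dw r : is_derive r (1 : R) (fun r => 'D_v f (x + s *: v + r *: w))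
    ('D_w ('D_v f) (x + s *: v + r *: w)).
  by apply/is_derive_line/smooth_derivable/smooth_derive.
have cw : {within `[0, h], continuous (fun r => 'D_v f (x + s *: v + r *: w))}.
  by apply: derivable_within_continuous => r _; case: (dw r).
have [r] := MVT h0 (fun r _ => dw r) cw.
rewrite in_itv/= => r0h Er.
exists s, r; split=> //; move: Es Er.
rewrite !fctE !scale0r !addr0 !subr0 !(addrAC x (h *: w)) => Es Er.
by rewrite expr2 mulrA -Er -Es; ring.
Qed.

(** The second difference is symmetric in [v] and [w], so the two mixed derivatives share a value at
    two points arbitrarily close to [x]. By continuity they cannot differ at [x]: with [e] half of a
    supposed gap, the triangle inequality fails. *)
Lemma derive_comm (R : realType) (U : normedModType R) (f : U -> R) (v w : U) :
  smooth f -> 'D_v ('D_w f) = 'D_w ('D_v f).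
Proof.
move=> sf; apply/funext => x; apply/eqP; rewrite -subr_eq0; apply: contraT => ab.
set A := 'D_v ('D_w f) in ab *; set B := 'D_w ('D_v f) in ab *.
have cA : continuous A by exact/smooth_continuous/smooth_derive/smooth_derive.
have cB : continuous B by exact/smooth_continuous/smooth_derive/smooth_derive.
pose e := `|A x - B x| / 2.
have e0 : 0 < e by rewrite divr_gt0// normr_gt0.
have NA : nbhs x [set y | `|A x - A y| < e].
  by have /cvgrPdist_lt/(_ _ e0) := cA x.
have NB : nbhs x [set y | `|B x - B y| < e].
  by have /cvgrPdist_lt/(_ _ e0) := cB x.
have [h1 h10 HA] := near_parallelogram w v NA.
have [h2 h20 HB] := near_parallelogram v w NB.
pose h := Num.min h1 h2.
have h0 : 0 < h by rewrite lt_min h10.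
have [s [r [sh rh E1]]] := second_difference x w v sf h0.
have [s' [r' [sh' rh' E2]]] := second_difference x v w sf h0.
have {}E1 : _ = A (x + s *: w + r *: v) * h ^+ 2 := E1.
have {}E2 : _ = B (x + s' *: v + r' *: w) * h ^+ 2 := E2.
clearbody A B.
have lth s0 : 0 < s0 < h -> 0 < s0 < h1 /\ 0 < s0 < h2.
  by rewrite lt_min => /andP[-> /andP[-> ->]].
have := HA s r (lth _ sh).1 (lth _ rh).1.
have := HB s' r' (lth _ sh').2 (lth _ rh').2.
have AB : A (x + s *: w + r *: v) = B (x + s' *: v + r' *: w).
  apply: (@mulIf _ (h ^+ 2)); first by rewrite expf_neq0// gt_eqF.
  by rewrite -E1 -E2 (addrAC x (h *: w)) (addrAC (f _)).
rewrite /= AB (distrC (B x)) => Hb Ha.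
have := le_lt_trans (ler_distD (B (x + s' *: v + r' *: w)) (A x) (B x))
  (ltrD Ha Hb).
by rewrite /e -splitr ltxx.
Qed.

Lemma dder_comm (R : realType) (U : normedModType R) (f : U -> R) (v w : U) :
  smooth f -> dder v (dder w f) = dder w (dder v f).
Proof. by rewrite dder.unlock; exact: derive_comm. Qed.

(** * Product and sum rules, and the maximum test with a weight along a line *)

Lemma is_derive_mul (R : realType) (U : normedModType R) (f g : U -> R)
    (z v : U) (df dg : R) :
  is_derive z v f df -> is_derive z v g dg ->
  is_derive z v (fun x => f x * g x) (df * g z + f z * dg).
Proof.
by move=> hf hg; apply: is_derive_eq (is_deriveM hf hg) _; rewrite /GRing.scale/=; ring.
Qed.

Lemma is_derive_bigsum (R : realType) (U : normedModType R) (n : nat)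
    (f : 'I_n -> U -> R) (z v : U) (df : 'I_n -> R) :
  (forall i, is_derive z v (f i) (df i)) ->
  is_derive z v (fun x => \sum_i f i x) (\sum_i df i).
Proof.
move=> h; have -> : (fun x => \sum_i f i x) = \sum_i f i.
  by apply/funext => x; rewrite fct_sumE.
exact: is_derive_sum.
Qed.

(** The second derivative test for [h |-> f (z + h *: v) * psi h], expanded by the product rule. A
    negative weight turns it into a test for minima. *)
Lemma weighted_derivative_at_max (R : realType) (U : normedModType R)
    (f : U -> R) (z v : U) (psi psi1 : R -> R) (psi2 e : R) :
  (forall x, derivable f x v) -> derivable (dder v f) z v ->
  (forall h : R, is_derive h 1 psi (psi1 h)) -> is_derive (0 : R) 1 psi1 psi2 ->
  0 < e ->
  (forall h, `|h| < e -> f (z + h *: v) * psi h <= f z * psi 0) ->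
  dder v f z * psi 0 + f z * psi1 0 = 0 /\
  dder v (dder v f) z * psi 0 + 2 * dder v f z * psi1 0 + f z * psi2 <= 0.
Proof.
rewrite dder.unlock => df ddf dpsi dpsi1 e0 fmax.
have d1 h := is_derive_mul (is_derive_line (df (z + h *: v))) (dpsi h).
have l1 := is_derive_line0 (df z).
have l2 := is_derive_line0 ddf.
have d2 := is_deriveD (is_derive_mul l2 (dpsi 0)) (is_derive_mul l1 dpsi1).
have fmax' h : `|h| < e -> f (z + h *: v) * psi h <= f (z + 0 *: v) * psi 0.
  by move=> /fmax; rewrite scale0r addr0.
have [] := second_derivative_at_max e0 (fun h _ => d1 h) d2 fmax'.
rewrite scale0r addr0 => -> D2; split=> //; apply: le_trans D2.
by rewrite le_eqVlt; apply/orP; left; apply/eqP; ring.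
Qed.

(** * Differential identities of the planning system in space-time *)

Section SpaceTime.
Context {R : realType} {d : nat}.
Local Notation Z := (R * 'rV[R]_d)%type.
Implicit Types (f U M W : Z -> R) (z : Z).

Definition dir_t : Z := (1, 0).
Definition dir_x (i : 'I_d) : Z := (0, delta_mx 0 i).

Definition lap_x f z : R := \sum_i dder (dir_x i) (dder (dir_x i) f) z.

(** The characteristic direction of the continuity equation at [z]. Once [z] is fixed it is a
    constant vector, so differentiation along it commutes with the space derivatives. *)
Definition velocity U z : Z := dir_t - \sum_i dder (dir_x i) U z *: dir_x i.

Lemma velocity1 U z : (velocity U z).1 = 1.
Proof.
rewrite /velocity /= (_ : (\sum_i _).1 = 0) ?subr0//.
by rewrite (big_morph fst (fun _ _ => erefl) erefl) big1// => i _; rewrite /= scaler0.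
Qed.

Lemma derive_velocity f U z0 z : differentiable f z ->
  dder (velocity U z0) f z = dder dir_t f z - \sum_i dder (dir_x i) U z0 * dder (dir_x i) f z.
Proof.
move=> df; have dE v : dder v f z = 'd f z v by rewrite -dderE; exact: deriveE.
rewrite !dE /velocity linearB linear_sum/=; congr (_ - _).
by apply: eq_bigr => i _; rewrite linearZ/= dE.
Qed.

Definition continuity_eq U M z :=
  dder dir_t M z = \sum_i (dder (dir_x i) M z * dder (dir_x i) U z
                      + M z * dder (dir_x i) (dder (dir_x i) U) z).

Definition hamiltonian U W z :=
  - dder dir_t U z + (\sum_i dder (dir_x i) U z ^+ 2) / 2 + W z.

Lemma transport U M z : smooth M -> continuity_eq U M z ->
  dder (velocity U z) M z = M z * lap_x U z.
Proof.
move=> sM ce; rewrite derive_velocity; last exact: smooth_differentiable.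
rewrite ce -sumrB mulr_sumr; apply: eq_bigr => i _; ring.
Qed.

Lemma transport2 U M z : smooth U -> smooth M ->
  (\forall y \near z, continuity_eq U M y) ->
  (forall i, dder (dir_x i) M z = 0) ->
  dder (velocity U z) (dder (velocity U z) M) z =
  dder (velocity U z) M z * lap_x U z + M z * lap_x (dder (velocity U z) U) z.
Proof.
move=> sU sM ce gM.
have hv : dder (velocity U z) M =
    fun y => dder dir_t M y - \sum_i dder (dir_x i) U z * dder (dir_x i) M y.
  by apply/funext => y; exact/derive_velocity/smooth_differentiable.
move: (velocity U z) hv => v hv.
have dv f : smooth f -> is_derive z v f (dder v f z) by exact: smooth_is_dder.
have E1 : dder v (dder v M) z =
    dder v (dder dir_t M) z - \sum_i dder (dir_x i) U z * dder v (dder (dir_x i) M) z.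
  apply: etrans (congr1 (fun f => dder v f z) hv) _.
  apply: dder_val; apply: (is_deriveB (dv _ (smooth_dder _ sM))).
  apply: is_derive_bigsum => i.
  apply: is_derive_eq (is_derive_mul (is_derive_cst _ _ _)
    (dv _ (smooth_dder (dir_x i) sM))) _.
  by rewrite mul0r add0r.
have E2 : dder v (dder dir_t M) z = \sum_i
    (dder v (dder (dir_x i) M) z * dder (dir_x i) U z
     + (dder v M z * dder (dir_x i) (dder (dir_x i) U) z
        + M z * dder (dir_x i) (dder (dir_x i) (dder v U)) z)).
  (* Both sides of the continuity equation agree near [z], so they have the same derivative
     there. *)
  rewrite -dderE; apply: etrans (near_eq_derive _ ce) _; rewrite dderE.
  apply: dder_val; apply: is_derive_bigsum => i; apply: is_deriveD.
    apply: is_derive_eq (is_derive_mul (dv _ (smooth_dder (dir_x i) sM))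
      (dv _ (smooth_dder (dir_x i) sU))) _.
    by rewrite gM mul0r addr0.
  apply: is_derive_eq (is_derive_mul (dv _ sM)
    (dv _ (smooth_dder (dir_x i) (smooth_dder (dir_x i) sU)))) _.
  have E3 : dder v (dder (dir_x i) (dder (dir_x i) U)) z = dder (dir_x i) (dder (dir_x i) (dder v U)) z.
    apply: etrans (congr1 (@^~ z) (dder_comm v (dir_x i) (smooth_dder (dir_x i) sU))) _.
    exact: (congr1 (fun f => dder (dir_x i) f z) (dder_comm v (dir_x i) sU)).
  exact: (congr1 (fun a => _ + M z * a) E3).
rewrite E1 E2 /lap_x !mulr_sumr -sumrB -big_split/=; apply: eq_bigr => i _.
by rewrite addrAC (mulrC (dder v (dder (dir_x i) M) z)) subrr add0r.
Qed.

(** Completing the square around the gradient at [z0]: the cross term is absorbed by the derivative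
    along the velocity. The remaining square vanishes to second order at [z0], so its Laplacian
    there is just the squared Hessian (up to the factor [1 / 2]). *)
Lemma hamiltonian_split U W z0 : smooth U ->
  hamiltonian U W = fun z => - dder (velocity U z0) U z
    + (\sum_i (dder (dir_x i) U z - dder (dir_x i) U z0) ^+ 2) / 2 + W z
    - (\sum_i dder (dir_x i) U z0 ^+ 2) / 2.
Proof.
move=> sU; apply/funext => z; rewrite derive_velocity; last exact: smooth_differentiable.
rewrite /hamiltonian opprB.
have -> : \sum_i (dder (dir_x i) U z - dder (dir_x i) U z0) ^+ 2 =
  \sum_i dder (dir_x i) U z ^+ 2 - 2 * (\sum_i dder (dir_x i) U z0 * dder (dir_x i) U z)
  + \sum_i dder (dir_x i) U z0 ^+ 2.
  by rewrite mulr_sumr -sumrB -big_split/=; apply: eq_bigr => i _; ring.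
by field.
Qed.

Lemma is_derive_hamiltonian U W z0 i z : smooth U -> smooth W ->
  is_derive z (dir_x i) (hamiltonian U W)
    (- dder (dir_x i) (dder (velocity U z0) U) z
     + \sum_j (dder (dir_x j) U z - dder (dir_x j) U z0) * dder (dir_x i) (dder (dir_x j) U) z
     + dder (dir_x i) W z).
Proof.
move=> sU sW; rewrite (hamiltonian_split _ z0 sU).
have dv f : smooth f -> is_derive z (dir_x i) f (dder (dir_x i) f z).
  exact: smooth_is_dder.
apply: is_derive_eq.
  apply: (is_deriveB _ (is_derive_cst _ _ _)).
  apply: (is_deriveD _ (dv _ sW)).
  apply: (is_deriveD (is_deriveN (dv _ (smooth_dder _ sU)))).
  apply: (is_derive_mul _ (is_derive_cst _ _ _)).
  apply: is_derive_bigsum => j.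
  exact: (is_deriveX 2 (is_deriveB (dv _ (smooth_dder (dir_x j) sU))
    (is_derive_cst _ _ _))).
rewrite mulr0 addr0 subr0; congr (_ + _ + _).
rewrite mulr_suml; apply: eq_bigr => j _.
rewrite subr0 -[X in X / 2]/(_ * _) !fctE expr1.
by field.
Qed.

Lemma derive_hamiltonian U W z0 i : smooth U -> smooth W ->
  dder (dir_x i) (hamiltonian U W) = fun z => - dder (dir_x i) (dder (velocity U z0) U) z
     + \sum_j (dder (dir_x j) U z - dder (dir_x j) U z0) * dder (dir_x i) (dder (dir_x j) U) z
     + dder (dir_x i) W z.
Proof.
by move=> sU sW; apply/funext => z; exact/dder_val/is_derive_hamiltonian.
Qed.

Lemma is_derive2_hamiltonian U W z i : smooth U -> smooth W ->
  is_derive z (dir_x i) (dder (dir_x i) (hamiltonian U W))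
    (- dder (dir_x i) (dder (dir_x i) (dder (velocity U z) U)) z
     + \sum_j dder (dir_x i) (dder (dir_x j) U) z ^+ 2 + dder (dir_x i) (dder (dir_x i) W) z).
Proof.
move=> sU sW; rewrite (derive_hamiltonian z i sU sW).
have dv f : smooth f -> is_derive z (dir_x i) f (dder (dir_x i) f z).
  exact: smooth_is_dder.
apply: (is_deriveD _ (dv _ (smooth_dder _ sW))).
apply: (is_deriveD
  (is_deriveN (dv _ (smooth_dder _ (smooth_dder _ sU))))).
apply: is_derive_bigsum => j.
apply: is_derive_eq (is_derive_mul
  (is_deriveB (dv _ (smooth_dder (dir_x j) sU)) (is_derive_cst _ _ _))
  (dv _ (smooth_dder (dir_x i) (smooth_dder (dir_x j) sU)))) _.
(* The gradient is frozen at [z] itself, so the third derivatives of [U] carry a zero factor. *)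
by rewrite !fctE subrr mul0r addr0 subr0 expr2.
Qed.

Lemma lapx_hamiltonian U W z : smooth U -> smooth W ->
  lap_x (hamiltonian U W) z = - lap_x (dder (velocity U z) U) z
    + (\sum_i \sum_j dder (dir_x i) (dder (dir_x j) U) z ^+ 2) + lap_x W z.
Proof.
move=> sU sW; rewrite /lap_x -sumrN -!big_split/=; apply: eq_bigr => i _.
exact/dder_val/is_derive2_hamiltonian.
Qed.

End SpaceTime.

(** * Periodic functions and extrema on a compact cylinder *)

Lemma periodic_int (R : realType) (d : nat) (f : 'rV[R]_d -> R) (x : 'rV[R]_d) i (n : int) :
  Defs.periodic f -> f (x + n%:~R *: delta_mx 0 i) = f x.
Proof.
move=> pf; have pn (m : nat) y : f (y + m%:R *: delta_mx 0 i) = f y.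
  elim: m y => [|m IH] y; first by rewrite scale0r addr0.
  by rewrite -natr1 scalerDl scale1r addrA pf IH.
case: n => m; first exact: pn.
by rewrite NegzE mulrNz scaleNr -(pn m.+1 (x - _)) subrK.
Qed.

Lemma periodic_unit_cell (R : realType) (d : nat) (f : 'rV[R]_d -> R) (x : 'rV[R]_d) :
  Defs.periodic f -> exists2 y : 'rV[R]_d, (forall i, 0 <= y 0 i <= 1) & f y = f x.
Proof.
move=> pf.
exists (x + \sum_(i < d) (- Num.floor (x 0 i))%:~R *: delta_mx 0 i).
  move=> j; rewrite mxE summxE (bigD1 j)//= big1 => [|i ij].
    rewrite !mxE !eqxx mulr1 addr0 mulrNz.
    by have := floor_itv (x 0 j); rewrite intrD; lra.
  by rewrite !mxE eqxx eq_sym (negbTE ij) mulr0.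
(* The vectors leaving [f] invariant are closed under addition, which reduces the claim to an
   integer multiple of one basis vector. *)
pose shift_inv v := forall y, f (y + v) = f y.
suff : shift_inv (\sum_(i < d) (- Num.floor (x 0 i))%:~R *: delta_mx 0 i) by exact.
apply: (big_ind shift_inv) => [y|u v Hu Hv y|i _ y].
- by rewrite addr0.
- by rewrite addrA Hv Hu.
- exact: periodic_int.
Qed.

Lemma compact_cylinder (R : realType) (d : nat) (a b : R) :
  compact (`[a, b]%classic `*`
    [set v : 'rV[R]_d | forall i, `[0, 1]%classic (v 0 i)]).
Proof.
apply: compact_setX; first exact: segment_compact.
exact: (@rV_compact R d (fun=> `[0, 1]%classic)
  (fun _ => @segment_compact R 0 1)).
Qed.

Lemma cylinder_cell_max (R : realType) (d : nat) (F : R * 'rV[R]_d -> R)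
    (a b : R) : a <= b -> continuous F ->
  exists z0 : R * 'rV[R]_d, [/\ a <= z0.1 <= b, (forall i, 0 <= z0.2 0 i <= 1) &
    forall z : R * 'rV[R]_d, a <= z.1 <= b -> (forall i, 0 <= z.2 0 i <= 1) -> F z <= F z0].
Proof.
move=> ab cF; have cA := @compact_cylinder R d a b.
set A := (X in compact X) in cA.
have A0 : A !=set0.
  exists (a, 0); split => /=; first by rewrite in_itv/= lexx.
  by move=> i; rewrite mxE in_itv/= lexx ler01.
have [[t0 x0]] := compact_EVT_max A0 cA (continuous_subspaceT cF).
rewrite inE => -[/= t0ab x0box] Fmax; exists (t0, x0); split => //.
move=> [t x] /= tab xbox; apply: Fmax; rewrite inE; split => /=.
  by rewrite in_itv.
by move=> i; rewrite in_itv/=; exact: xbox.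
Qed.

Lemma cylinder_max (R : realType) (d : nat) (F : R * 'rV[R]_d -> R) (a b : R) :
  a <= b -> continuous F -> (forall t, Defs.periodic (fun x => F (t, x))) ->
  exists z0 : R * 'rV[R]_d, [/\ a <= z0.1 <= b, (forall i, 0 <= z0.2 0 i <= 1) &
    forall z, a <= z.1 <= b -> F z <= F z0].
Proof.
move=> ab cF pF; have [z0 [z0ab z0box Fmax]] := cylinder_cell_max ab cF.
exists z0; split => // -[t x] /= tab.
by have [y ybox <-] := periodic_unit_cell x (pF t); exact: Fmax.
Qed.

Lemma cylinder_cell_bounded (R : realType) (d : nat) (F : R * 'rV[R]_d -> R)
    (a b : R) : a <= b -> continuous F ->
  exists C : R, 0 <= C /\ forall z : R * 'rV[R]_d, a <= z.1 <= b ->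
    (forall i, 0 <= z.2 0 i <= 1) -> `|F z| <= C.
Proof.
move=> ab cF.
have cNF : continuous (fun z => `|F z|).
  by move=> z; apply: cvg_norm; exact: cF.
by have [z0 [_ _ Fmax]] := cylinder_cell_max ab cNF; exists `|F z0|; split.
Qed.

(** * The maximum principle for the weighted density *)

Section MaximumPrinciple.
Context {R : realType} {d : nat}.
Local Notation Z := (R * 'rV[R]_d)%type.
Implicit Types (U M W : Z -> R) (z : Z).

(** Smoothness and periodicity hold for all times, so lines may leave the cylinder freely. The
    equations and the sign of [M] are kept only where the original solution provides them. *)
Record extended_solution (T alpha : R) U M W : Prop := {
  es_U : smooth U;
  es_M : smooth M;
  es_W : smooth W;
  es_periodic : forall t, Defs.periodic (fun x => M (t, x));
  es_ge0 : forall z, 0 <= z.1 <= T -> 0 <= M z;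
  es_hj : forall z, 0 < z.1 < T -> hamiltonian U W z = M z `^ alpha;
  es_ce : forall z, 0 < z.1 < T -> continuity_eq U M z }.

Lemma near_time (T : R) z : 0 < z.1 < T -> \forall y \near z, 0 < y.1 < T.
Proof.
move=> /andP[z0 zT]; have c : continuous (@fst R 'rV[R]_d) by move=> y; exact: cvg_fst.
near=> y; apply/andP; split; near: y.
- exact: (cvgr_gt z.1 (c z)).
- exact: (cvgr_lt z.1 (c z)).
Unshelve. all: by end_near. Qed.

Lemma is_derive_addl (t h : R) : is_derive h (1 : R) (fun s => t + s) 1.
Proof.
by apply: is_derive_eq (is_deriveD (is_derive_cst t h 1) (is_derive_id h 1)) _;
  rewrite add0r.
Qed.

(** The weight of part (i) along a line starting at time [t] and moving with the velocity, whose
    time component is [1]. *)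
Lemma is_derive_gauss (K t h : R) :
  is_derive h (1 : R) (fun s => expR (K / 2 * (t + s) ^+ 2))
    (expR (K / 2 * (t + h) ^+ 2) * (K * (t + h))).
Proof.
have d1 := is_derive_addl t h.
have d2 := is_derive_mul (is_derive_cst (K / 2) h 1) (is_derive_mul d1 d1).
have := is_derive1_comp (is_derive_expR _) d2.
have -> : expR \o (fun x => cst (K / 2) x * ((t + x) * (t + x))) =
    fun s => expR (K / 2 * (t + s) ^+ 2).
  by apply/funext => s; rewrite /= -expr2.
by move/is_derive_eq; apply; rewrite /cst -expr2; field.
Qed.

Lemma max_derivatives (f : Z -> R) z v :
  (forall x, derivable f x v) -> derivable (dder v f) z v ->
  (forall h, f (z + h *: v) <= f z) -> dder v f z = 0 /\ dder v (dder v f) z <= 0.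
Proof.
move=> df ddf fmax.
have [|] := weighted_derivative_at_max df ddf (fun h : R => is_derive_cst (1 : R) h (1 : R))
  (is_derive_cst (0 : R) (0 : R) (1 : R)) ltr01.
  by move=> h _; rewrite /cst !mulr1.
by rewrite /cst !mulr0 !mulr1 !addr0.
Qed.

Lemma min_derivatives (f : Z -> R) z v :
  (forall x, derivable f x v) -> derivable (dder v f) z v ->
  (forall h, f z <= f (z + h *: v)) -> dder v f z = 0 /\ 0 <= dder v (dder v f) z.
Proof.
move=> df ddf fmin.
(* The constant weight [-1] turns the minimum into a maximum. *)
have [|] := weighted_derivative_at_max df ddf (fun h : R => is_derive_cst (-1 : R) h (1 : R))
  (is_derive_cst (0 : R) (0 : R) (1 : R)) ltr01.
  by move=> h _; rewrite /cst !mulrN1 lerN2.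
rewrite /cst !mulr0 !mulrN1 !addr0 oppr_le0 => /eqP.
by rewrite oppr_eq0 => /eqP.
Qed.

Lemma space_shift z h (i : 'I_d) : (z + h *: dir_x i).1 = z.1.
Proof. by rewrite /= scaler0 addr0. Qed.

Lemma velocity_shift U z z0 h : (z + h *: velocity U z0).1 = z.1 + h.
Proof. by rewrite -[LHS]/(z.1 + h * (velocity U z0).1) velocity1 mulr1. Qed.

Lemma time_ball (T : R) z : 0 < z.1 < T ->
  exists2 e : R, 0 < e & forall h, `|h| < e -> 0 <= z.1 + h <= T.
Proof.
move=> zT; exists (Num.min z.1 (T - z.1)); first by rewrite lt_min; lra.
by move=> h; rewrite lt_min !ltr_norml; lra.
Qed.

Lemma derivable_hamiltonian U W i x : smooth U -> smooth W ->
  derivable (hamiltonian U W) x (dir_x i).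
Proof. by move=> sU sW; case: (is_derive_hamiltonian x i x sU sW). Qed.

Lemma derivable2_hamiltonian U W i x : smooth U -> smooth W ->
  derivable (dder (dir_x i) (hamiltonian U W)) x (dir_x i).
Proof. by move=> sU sW; case: (is_derive2_hamiltonian x i sU sW). Qed.

(** The Hamilton-Jacobi equation makes the Hamiltonian an increasing function of the density.
    Spatial extrema of [M] are thus extrema of the Hamiltonian, and the power never has to be
    differentiated. *)
Lemma hamiltonian_le T alpha U M W z z' : 0 < alpha ->
  extended_solution T alpha U M W -> 0 < z.1 < T -> 0 < z'.1 < T ->
  M z <= M z' -> hamiltonian U W z <= hamiltonian U W z'.
Proof.
move=> a0 es zT z'T MM; rewrite !(es_hj es)//.
by rewrite ge0_ler_powR ?nnegrE ?(es_ge0 es)//; lra.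
Qed.

Lemma velocity_second_derivative T alpha U M W z :
  extended_solution T alpha U M W -> 0 < z.1 < T ->
  (forall i, dder (dir_x i) M z = 0) ->
  dder (velocity U z) (dder (velocity U z) M) z =
  dder (velocity U z) M z * lap_x U z + M z * lap_x (dder (velocity U z) U) z.
Proof.
move=> es zT gM; apply: transport2 gM; [exact: (es_U es)|exact: (es_M es)|].
by near=> y; apply: (es_ce es); near: y; exact: near_time.
Unshelve. all: by end_near. Qed.

(** A spatial maximum of [M] gives a vanishing gradient and a nonpositive Laplacian of the
    Hamiltonian, so [lap_x W z0] is at most the Laplacian of the derivative of [U] along the
    velocity, the squared Hessian being nonnegative. The second-order test along the velocity bounds
    that Laplacian by [- K]. *)
Lemma interior_max T alpha U M W K z0 : 0 < alpha ->
  extended_solution T alpha U M W -> 0 < z0.1 < T -> 0 < M z0 ->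
  (forall z, 0 <= z.1 <= T ->
    M z * expR (K / 2 * z.1 ^+ 2) <= M z0 * expR (K / 2 * z0.1 ^+ 2)) ->
  K + lap_x W z0 <= 0.
Proof.
move=> a0 es z0T M0 Mmax.
have [sU sM sW] := And3 (es_U es) (es_M es) (es_W es).
have Mspace i h : M (z0 + h *: dir_x i) <= M z0.
  have := Mmax (z0 + h *: dir_x i); rewrite space_shift.
  by rewrite ler_pM2r ?expR_gt0//; apply; lra.
have gM i : dder (dir_x i) M z0 = 0.
  apply: (proj1 (@max_derivatives M z0 (dir_x i) _ _ (Mspace i))).
    by move=> x; exact: smooth_derivable.
  exact/smooth_derivable/smooth_dder.
have P0 : lap_x (hamiltonian U W) z0 <= 0.
  apply: sumr_le0 => i _.
  apply: (proj2 (@max_derivatives (hamiltonian U W) z0 (dir_x i) _ _ _)).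
  - by move=> x; exact: derivable_hamiltonian.
  - exact: derivable2_hamiltonian.
  - by move=> h; apply: (hamiltonian_le a0 es) => //; rewrite space_shift.
have S0 : 0 <= \sum_i \sum_j dder (dir_x i) (dder (dir_x j) U) z0 ^+ 2.
  by apply: sumr_ge0 => i _; apply: sumr_ge0 => j _; exact: sqr_ge0.
have H3 := transport sM (es_ce es z0T).
have H4 := velocity_second_derivative es z0T gM.
have H5 := lapx_hamiltonian z0 sU sW.
have [e e0 eT] := time_ball z0T.
have dpsi1 := is_derive_mul (is_derive_gauss K z0.1 0)
  (is_derive_mul (is_derive_cst K (0 : R) (1 : R)) (is_derive_addl z0.1 0)).
have := @weighted_derivative_at_max _ _ M z0 (velocity U z0) _ _ _ _
  (fun=> smooth_derivable sM) (smooth_derivable (smooth_dder _ sM))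
  (is_derive_gauss K z0.1) dpsi1 e0.
move=> [h /eT hT|]; first by rewrite -(velocity_shift U _ z0) addr0 Mmax// velocity_shift.
move: H3 H4 H5 P0 S0 (expR_gt0 (K / 2 * (z0.1 + 0) ^+ 2)); rewrite /cst addr0.
move: (dder _ M z0) (dder _ (dder _ M) z0) (lap_x U z0) (lap_x (dder _ U) z0)
  (lap_x (hamiltonian U W) z0) (lap_x W z0) (\sum_i _) (expR _) M0 => a b D L P w S E.
move: (M z0) (z0.1) => m t m0 -> -> -> {P} P0 S0 E0 H1 H2.
(* The first-order condition along the velocity. *)
have HD : D = - (K * t).
  apply: (mulfI (lt0r_neq0 m0)); apply: (mulfI (lt0r_neq0 E0)).
  by move/eqP: H1; rewrite addr_eq0 => /eqP; lra.
(* The terms quadratic in [D] and [K * t] add up to [(D + K * t) ^+ 2], which is zero. *)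
have : E * m * (L + K) <= 0 by move: H2; rewrite HD; lra.
by rewrite pmulr_rle0 ?mulr_gt0//; lra.
Qed.

End MaximumPrinciple.

(** * The upper bound, and positivity of the density *)

Section Bounds.
Context {R : realType} {d : nat}.
Local Notation Z := (R * 'rV[R]_d)%type.
Implicit Types (U M W : Z -> R) (z : Z).

Lemma continuous_time_weight M (phi : R -> R) :
  continuous M -> continuous phi -> continuous (fun z => M z * phi z.1).
Proof.
move=> cM cphi z; apply: cvgM; first exact: cM.
by apply: (@cvg_comp _ _ _ fst phi); [exact: cvg_fst|exact: cphi].
Qed.

Lemma is_derive_continuous (phi phi1 : R -> R) :
  (forall t : R, is_derive t 1 phi (phi1 t)) -> continuous phi.
Proof.
by move=> dphi t; apply/differentiable_continuous/derivable1_diffP; case: (dphi t).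
Qed.

Lemma smooth_lapx_continuous U : smooth U -> continuous (lap_x U).
Proof.
move=> sU z; have -> : lap_x U = \sum_i dder (dir_x i) (dder (dir_x i) U).
  by apply/funext => y; rewrite fct_sumE.
apply/differentiable_continuous/differentiable_sum => i.
exact/smooth_differentiable/smooth_dder/smooth_dder.
Qed.

(** The strict bound [WK] rules out an interior maximum of the weighted density with [M] positive,
    leaving the end times or a nonpositive value. The weight is at least [1], so dropping it at [z]
    is free; at time [T] it costs the exponential factor. *)
Lemma density_upper_bound T alpha U M W (K C0 : R) :
  0 < T -> 0 < alpha -> extended_solution T alpha U M W ->
  0 <= K -> 0 <= C0 ->
  (forall z, 0 <= z.1 <= T -> (forall i, 0 <= z.2 0 i <= 1) ->
    - lap_x W z < K) ->
  (forall x, M (0, x) <= C0) -> (forall x, M (T, x) <= C0) ->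
  forall z, 0 <= z.1 <= T -> M z <= C0 * expR (K / 2 * T ^+ 2).
Proof.
move=> T0 a0 es K0 C00 WK M0 MT z zT.
have cg : continuous (fun t : R => expR (K / 2 * t ^+ 2)).
  have -> : (fun t : R => expR (K / 2 * t ^+ 2)) =
      fun t => expR (K / 2 * (0 + t) ^+ 2) by apply/funext => t; rewrite add0r.
  exact: is_derive_continuous (is_derive_gauss K 0).
have pF t : Defs.periodic (fun x => M (t, x) * expR (K / 2 * t ^+ 2)).
  by move=> x i; rewrite (es_periodic es).
have [z0 [z0T z0box Fmax]] := cylinder_max (ltW T0)
  (continuous_time_weight (smooth_continuous (es_M es)) cg) pF.
have E1 s : 1 <= expR (K / 2 * s ^+ 2).
  by rewrite -expR0 ler_expR mulr_ge0 ?sqr_ge0// divr_ge0.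
apply: le_trans (_ : M z0 * expR (K / 2 * z0.1 ^+ 2) <= _).
  by apply: le_trans (Fmax _ zT); rewrite ler_peMr// (es_ge0 es).
have [z00|z00] := eqVneq z0.1 0.
  rewrite z00 expr0n/= mulr0 expR0 mulr1 (le_trans _ (ler_peMr C00 (E1 T)))//.
  by move: z00; case: (z0) => t x /= ->.
have [z0T'|z0T'] := eqVneq z0.1 T.
  rewrite z0T' ler_wpM2r ?expR_ge0//.
  by move: z0T'; case: (z0) => t x /= ->.
have z0T'' : 0 < z0.1 < T by case/andP: z0T => z0a z0b; rewrite !lt_neqAle z0T' eq_sym z00 z0a.
have [Mz0|Mz0] := ltP 0 (M z0); last first.
  apply: le_trans (_ : 0 <= _); last by rewrite mulr_ge0// expR_ge0.
  by rewrite mulr_le0_ge0 ?expR_ge0.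
have := interior_max a0 es z0T'' Mz0 Fmax.
by have := WK _ z0T z0box; lra.
Qed.

(** With [K] bounding the Laplacian of [U], [M exp (K t)] has nonnegative derivative along the
    velocity, and the term [eps t] makes it strictly positive, so the minimum of [F] sits at an end
    time. As [K] depends on the solution, this is only a qualitative statement. *)
Lemma density_positive T alpha U M W (k0 : R) :
  0 < T -> extended_solution T alpha U M W -> 0 < k0 ->
  (forall x, k0 <= M (0, x)) -> (forall x, k0 <= M (T, x)) ->
  forall z, 0 <= z.1 <= T -> 0 < M z.
Proof.
move=> T0 es k00 M0 MT z zT.
have sM := es_M es.
have [K [K0 UK]] := cylinder_cell_bounded (ltW T0) (smooth_lapx_continuous (es_U es)).
(* With this choice [eps t] is at most [k0 / 2], half of the lower bound for [F]. *)
pose eps := k0 / (2 * T).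
have eps0 : 0 < eps by rewrite divr_gt0// mulr_gt0.
pose F z := M z * expR (K * z.1) + eps * z.1.
have dE t : is_derive t (1 : R) (fun s => expR (K * s)) (expR (K * t) * K).
  have := is_derive1_comp (is_derive_expR _)
    (is_derive_mul (is_derive_cst K t 1) (is_derive_id t 1)).
  by move/is_derive_eq; apply; rewrite mul0r add0r mulr1.
have cF : continuous (fun z => - F z).
  move=> y; apply: cvgN; apply: cvgD.
    exact: (continuous_time_weight (smooth_continuous sM) (is_derive_continuous dE)).
  by apply: cvgM; [exact: cvg_cst|exact: cvg_fst].
have pF t : Defs.periodic (fun x => - F (t, x)).
  by move=> x i; rewrite /F (es_periodic es).
have [z0 [z0T z0box Fmin]] := cylinder_max (ltW T0) cF pF.
suff Fz0 : k0 <= F z0.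
  have : k0 <= F z by rewrite (le_trans Fz0)// -lerN2 Fmin.
  rewrite /F => k0F.
  have epsT : eps * z.1 <= k0 / 2.
    have -> : k0 / 2 = eps * T by rewrite /eps; field; rewrite gt_eqF.
    by rewrite ler_pM2l//; lra.
  have : 0 < M z * expR (K * z.1) by lra.
  by rewrite pmulr_lgt0// expR_gt0.
have [z00|z00] := eqVneq z0.1 0.
  rewrite /F z00 !mulr0 expR0 mulr1 addr0.
  by move: z00; case: (z0) => t x /= ->.
have [z0T'|z0T'] := eqVneq z0.1 T.
  rewrite /F z0T' (le_trans (_ : k0 <= M z0))//.
    by move: z0T'; case: (z0) => t x /= ->.
  rewrite -[leLHS]addr0 lerD//; last by rewrite mulr_ge0//; lra.
  by rewrite ler_peMr ?(es_ge0 es)// -expR0 ler_expR mulr_ge0//; lra.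
have z0T'' : 0 < z0.1 < T by case/andP: z0T => z0a z0b; rewrite !lt_neqAle z0T' eq_sym z00 z0a.
have [e e0 eT] := time_ball z0T''.
set v := velocity U z0.
pose g (h : R) := M (z0 + h *: v) * expR (K * (z0.1 + h)) + eps * (z0.1 + h).
have dg h : is_derive h (1 : R) g
  (dder v M (z0 + h *: v) * expR (K * (z0.1 + h))
   + M (z0 + h *: v) * (expR (K * (z0.1 + h)) * K) + eps).
  have d1 := is_derive_line (smooth_derivable (x := z0 + h *: v) (v := v) sM).
  have d2 := is_derive1_comp (dE (z0.1 + h)) (is_derive_addl z0.1 h).
  have d3 := is_derive_mul (is_derive_cst eps h 1) (is_derive_addl z0.1 h).
  have := is_deriveD (is_derive_mul d1 d2) d3.
  by move/is_derive_eq; apply; rewrite dderE mul0r add0r !mulr1.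
have : is_derive (0 : R) 1 g 0.
  apply: (@derive1_at_min _ _ (- e) e) => [|t _|| h].
  - by lra.
  - by case: (dg t).
  - by rewrite in_itv/=; lra.
  rewrite in_itv/= -ltr_norml => /eT hT.
  have := Fmin (z0 + h *: v); rewrite velocity_shift => /(_ hT).
  by rewrite lerN2 /F velocity_shift /g scale0r !addr0.
case=> _; have [_ ->] := dg 0.
rewrite scale0r !addr0 (transport sM (es_ce es z0T'')) => /eqP.
have := UK _ z0T z0box; rewrite ler_norml => /andP[UK1 _].
(* The derivative of [g] at [0] is at least [eps], contradicting that it vanishes at a minimum. *)
rewrite gt_eqF// ltr_wpDl// (_ : _ + _ = M z0 * (lap_x U z0 + K) * expR (K * z0.1)).
  by rewrite mulr_ge0 ?expR_ge0// mulr_ge0 ?(es_ge0 es)//; lra.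
by ring.
Qed.

End Bounds.

(** * The uniform lower bound in dimension one *)

Section LowerBound.
Context {R : realType}.
Local Notation Z := (R * 'rV[R]_1)%type.
Implicit Types (U M W : Z -> R) (z : Z).

(** The weight carries a minus sign so that the maximum test applies to a minimum of the density
    times the parabola. *)
Lemma is_derive_parabola (T t h : R) :
  is_derive h (1 : R) (fun s => - (1 + (t + s) * (T - (t + s)) / T ^+ 2))
    (- ((T - 2 * (t + h)) / T ^+ 2)).
Proof.
have d1 := is_derive_addl t h.
have d2 := is_deriveB (is_derive_cst T h 1) d1.
have := is_deriveN (is_deriveD (is_derive_cst (1 : R) h 1)
  (is_derive_mul (is_derive_mul d1 d2) (is_derive_cst (T ^- 2) h 1))).
move/is_derive_eq; apply.
by rewrite !fctE; ring.
Qed.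

Lemma is_derive_parabola' (T t h : R) :
  is_derive h (1 : R) (fun s => - ((T - 2 * (t + s)) / T ^+ 2)) (2 / T ^+ 2).
Proof.
have d1 := is_derive_mul (is_derive_cst (2 : R) h 1) (is_derive_addl t h).
have d2 := is_deriveB (is_derive_cst T h 1) d1.
have := is_deriveN (is_derive_mul d2 (is_derive_cst (T ^- 2) h 1)).
move/is_derive_eq; apply.
by rewrite !fctE; ring.
Qed.

(** At a minimum the Laplacian of the Hamiltonian is nonnegative, so the squared Hessian now has the
    unfavourable sign. In dimension one it equals [lap_x U z0 ^+ 2], and the first-order condition
    along the velocity produces exactly this square to cancel it. *)
Lemma interior_min T alpha U M W z0 : 0 < alpha ->
  extended_solution T alpha U M W -> 0 < z0.1 < T -> 0 < M z0 ->
  (forall z, 0 <= z.1 <= T ->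
    M z0 * (1 + z0.1 * (T - z0.1) / T ^+ 2) <=
    M z * (1 + z.1 * (T - z.1) / T ^+ 2)) ->
  2 / T ^+ 2 <= lap_x W z0 * (1 + z0.1 * (T - z0.1) / T ^+ 2).
Proof.
move=> a0 es z0T M0 Mmin.
have [sU sM sW] := And3 (es_U es) (es_M es) (es_W es).
have phi0 : 0 < 1 + z0.1 * (T - z0.1) / T ^+ 2.
  by rewrite ltr_pwDl// divr_ge0 ?sqr_ge0// mulr_ge0//; lra.
have Mspace i h : M z0 <= M (z0 + h *: dir_x i).
  have := Mmin (z0 + h *: dir_x i); rewrite space_shift.
  by rewrite ler_pM2r//; apply; lra.
have gM i : dder (dir_x i) M z0 = 0.
  apply: (proj1 (@min_derivatives _ _ M z0 (dir_x i) _ _ (Mspace i))).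
    by move=> x; exact: smooth_derivable.
  exact/smooth_derivable/smooth_dder.
have P0 : 0 <= lap_x (hamiltonian U W) z0.
  apply: sumr_ge0 => i _.
  apply: (proj2 (@min_derivatives _ _ (hamiltonian U W) z0 (dir_x i) _ _ _)).
  - by move=> x; exact: derivable_hamiltonian.
  - exact: derivable2_hamiltonian.
  - by move=> h; apply: (hamiltonian_le a0 es) => //; rewrite space_shift.
have H3 := transport sM (es_ce es z0T).
have H4 := velocity_second_derivative es z0T gM.
have H5 := lapx_hamiltonian z0 sU sW.
have S0 : \sum_i \sum_j dder (dir_x i) (dder (dir_x j) U) z0 ^+ 2 = lap_x U z0 ^+ 2.
  by rewrite /lap_x !big_ord1.
have [e e0 eT] := time_ball z0T.
have := @weighted_derivative_at_max _ _ M z0 (velocity U z0) _ _ _ _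
  (fun=> smooth_derivable sM) (smooth_derivable (smooth_dder _ sM))
  (is_derive_parabola T z0.1) (is_derive_parabola' T z0.1 0) e0.
move=> [h /eT hT|].
  rewrite !mulrN lerN2 addr0 -(velocity_shift U _ z0) Mmin//.
  by rewrite velocity_shift.
move: H3 H4 H5 P0 phi0; rewrite S0 addr0.
move: (dder _ M z0) (dder _ (dder _ M) z0) (lap_x U z0) (lap_x (dder _ U) z0)
  (lap_x (hamiltonian U W) z0) (lap_x W z0) M0 => a b D L P w.
move: (1 + _) => phi; move: (_ / T ^+ 2) => k; move: (_ / T ^+ 2) => phi1.
move: (M z0) => m m0 -> -> -> {P}.
move=> P0 phi0 H1 H2.
have HD : phi1 = - (D * phi).
  by apply: (mulfI (lt0r_neq0 m0)); lra.
(* Substituting [phi1] turns [2 * D * phi1] into [- 2 * D ^+ 2 * phi], which reverses the sign of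
   the square coming from the transport equation. *)
have : m * (k - (L - D ^+ 2) * phi) <= 0 by move: H2; rewrite HD; lra.
rewrite pmulr_rle0// subr_le0 => /le_trans; apply.
by rewrite ler_pM2r//; lra.
Qed.

Lemma parabola_bounds (T t : R) : 0 < T -> 0 <= t <= T ->
  1 <= 1 + t * (T - t) / T ^+ 2 <= 5 / 4.
Proof.
move=> T0 tT; have T2 : 0 < T ^+ 2 by rewrite exprn_gt0.
have t0 : 0 <= t * (T - t) / T ^+ 2.
  by apply: divr_ge0; [apply: mulr_ge0; lra|exact: ltW].
rewrite lerDl t0/=; suff : t * (T - t) / T ^+ 2 <= 1 / 4 by lra.
rewrite ler_pdivrMr//.
by have := sqr_ge0 (T - 2 * t); lra.
Qed.

(** An interior minimum of the weighted density would give [2 <= c * T ^+ 2 * phi <= 5 / 4]. At the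
    end times the weight is [1], so the minimum is at least [k0]; the factor [4 / 5] comes from
    [phi <= 5 / 4]. *)
Lemma density_lower_bound T alpha U M W (c k0 : R) :
  0 < T -> 0 < alpha -> extended_solution T alpha U M W ->
  c * T ^+ 2 <= 1 -> 0 < k0 ->
  (forall z, 0 < z.1 < T -> (forall i, 0 <= z.2 0 i <= 1) -> lap_x W z <= c) ->
  (forall x, k0 <= M (0, x)) -> (forall x, k0 <= M (T, x)) ->
  forall z, 0 <= z.1 <= T -> k0 * (4 / 5) <= M z.
Proof.
move=> T0 a0 es cT k00 Wc M0 MT z zT.
have Mpos := density_positive T0 es k00 M0 MT.
pose phi (t : R) := 1 + t * (T - t) / T ^+ 2.
have cphi : continuous phi.
  move=> t; rewrite /phi; apply: cvgD; first exact: cvg_cst.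
  apply: cvgM; last exact: cvg_cst.
  apply: cvgM; first exact: cvg_id.
  by apply: cvgB; [exact: cvg_cst|exact: cvg_id].
have cF : continuous (fun y => - (M y * phi y.1)).
  move=> y; apply: cvgN.
  exact: (continuous_time_weight (smooth_continuous (es_M es)) cphi).
have pF t : Defs.periodic (fun x => - (M (t, x) * phi t)).
  by move=> x i; rewrite (es_periodic es).
have [z0 [z0T z0box Fmin]] := cylinder_max (ltW T0) cF pF.
have T2 : 0 < T ^+ 2 by rewrite exprn_gt0.
suff Fz0 : k0 <= M z0 * phi z0.1.
  have F1 : k0 <= M z * phi z.1 by rewrite (le_trans Fz0)// -lerN2 Fmin.
  have /andP[phi1 phi2] := parabola_bounds T0 zT.
  have : M z * phi z.1 <= M z * (5 / 4) by rewrite ler_pM2l// Mpos.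
  by lra.
have [z00|z00] := eqVneq z0.1 0.
  rewrite z00 /phi mul0r mul0r addr0 mulr1.
  by move: z00; case: (z0) => t x /= ->.
have [z0T'|z0T'] := eqVneq z0.1 T.
  rewrite z0T' /phi subrr mulr0 mul0r addr0 mulr1.
  by move: z0T'; case: (z0) => t x /= ->.
have z0T'' : 0 < z0.1 < T.
  by case/andP: z0T => z0a z0b; rewrite !lt_neqAle z0T' eq_sym z00 z0a.
have Mmin y : 0 <= y.1 <= T -> M z0 * phi z0.1 <= M y * phi y.1.
  by move=> /Fmin; rewrite lerN2.
have := interior_min a0 es z0T'' (Mpos _ z0T) Mmin.
have /andP[phi1 phi2] := parabola_bounds T0 z0T.
have Wcz := Wc _ z0T'' z0box.
rewrite ler_pdivrMr// -/(phi _) => H.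
have : lap_x W z0 * phi z0.1 * T ^+ 2 <= c * phi z0.1 * T ^+ 2.
  by rewrite ler_pM2r// ler_pM2r// (lt_le_trans ltr01).
have : c * T ^+ 2 * phi z0.1 <= 1 * phi z0.1.
  by rewrite ler_pM2r// (lt_le_trans ltr01).
move: phi1 phi2 H; rewrite -/(phi _); move: (phi _) => f; lra.
Qed.

End LowerBound.

(** * Essential suprema against pointwise bounds *)

Lemma Linfty_torus_le (R : realType) (d : nat) (f : 'rV[R]_d -> \bar R) (C : R) :
  0 <= C -> (forall x, `|f x| <= C%:E)%E -> (Linfty_torus f <= C%:E)%E.
Proof.
(* The norm is [0] by convention when the whole space has no positive measure; that branch is
   settled by [0 <= C]. *)
move=> C0 fC; rewrite /Linfty_torus unlock; case: ifPn => _; last by rewrite lee_fin.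
by apply/ess_supP; apply: nearW => x; exact: fC.
Qed.

(** [torus_measure 1] is the image of a product with the point mass on empty tuples, so the slab
    pulls back to an interval times the whole second factor. *)
Lemma torus_measure1_slab (R : realType) (a b : R) : 0 <= a -> a < b -> b <= 1 ->
  measurable [set v : 1.-tuple (measurableTypeR R) | tnth v ord0 \in `]a, b[] /\
  torus_measure 1 [set v | tnth v ord0 \in `]a, b[] = (b - a)%:E.
Proof.
move=> a0 ab b1.
set B := [set v | _].
have mB : measurable B.
  have := @measurable_tnth _ (measurableTypeR R) 1 ord0 measurableT _
    (measurable_itv `]a, b[).
  by rewrite setTI.
split=> //.
have EB : @tcons R 0 @^-1` B = `]a, b[%classic `*` setT.
  apply/seteqP; split => z; rewrite /B/= (tnth_nth 0)/=; first by split.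
  by case.
have -> : torus_measure 1 B =
    (@unit_interval_measure R \x torus_measure 0)%E (@tcons R 0 @^-1` B) by [].
rewrite EB.
rewrite product_measure1E//.
have T1 : torus_measure 0 [set: 0.-tuple (measurableTypeR R)] = 1%E.
  exact: probability_setT.
rewrite [X in (_ * X)%E]T1 mule1.
transitivity (@lebesgue_measure R (`]a, b[ `&` `[0, 1])%classic) => //.
rewrite setIidl.
  by rewrite lebesgue_measure_itv/= lte_fin ab EFinB.
exact: subset_itvW.
Qed.

Lemma slab_time_measure (R : realType) (T a b : R) : 0 <= a -> a < b -> b <= T ->
  time_measure T `]a, b[%classic = (b - a)%:E.
Proof.
move=> a0 ab bT.
rewrite /time_measure/= /mrestr/= setIidl.
  by rewrite lebesgue_measure_itv/= lte_fin ab EFinB.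
exact: subset_itvW.
Qed.

(** An essential bound on a continuous function holds pointwise: if [c < |F z|], this persists on a
    ball around [z], which meets the cylinder in a set of positive measure. *)
Lemma Linfty_cylinder_bound (R : realType) (T c : R) (g : R -> 'rV[R]_1 -> R)
    (F : R * 'rV[R]_1 -> R) : continuous F ->
  (forall t x, 0 <= t <= T -> g t x = F (t, x)) ->
  (Linfty_cylinder T (fun t x => (g t x)%:E) <= c%:E)%E ->
  forall z : R * 'rV[R]_1, 0 < z.1 < T -> (forall i, 0 <= z.2 0 i <= 1) ->
    `|F z| <= c.
Proof.
move=> cF gF Lc z zT zbox; rewrite leNgt; apply/negP => Fz.
have : \forall y \near z, c < `|F y|.
  have cNF : (fun y => `|F y|) @ z --> `|F z| by apply: cvg_norm; exact: cF.
  exact: (cvgr_gt _ cNF).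
move=> /nbhs_ballP[r /= r0 rP].
(* The ball is clipped to the cylinder. The space interval stays nondegenerate even when [z] lies on
   the boundary of the unit cell. *)
pose a0 := Num.max 0 (z.1 - r); pose b0 := Num.min T (z.1 + r).
pose a1 := Num.max 0 (z.2 0 ord0 - r); pose b1 := Num.min 1 (z.2 0 ord0 + r).
have z2 := zbox ord0.
have [a00 a01] : 0 <= a0 /\ 0 <= a1 by rewrite /a0 /a1 !le_max lexx.
have [b0T b11] : b0 <= T /\ b1 <= 1 by rewrite /b0 /b1 !ge_min !lexx.
have ab0 : a0 < b0.
  by rewrite gt_max !lt_min; apply/andP; split; apply/andP; split; lra.
have ab1 : a1 < b1.
  by rewrite gt_max !lt_min; apply/andP; split; apply/andP; split; lra.
have [mB EB] := torus_measure1_slab a01 ab1 b11.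
set B := [set v : 1.-tuple (measurableTypeR R) | tnth v ord0 \in `]a1, b1[] in mB EB.
pose A : set (measurableTypeR R * 1.-tuple (measurableTypeR R)) := `]a0, b0[%classic `*` B.
pose mu := (@time_measure R T \x torus_measure 1)%E.
have mA : measurable A by apply: measurableX => //; exact: measurable_itv.
have muA : (0 < mu A)%E.
  rewrite /mu /A product_measure1E//.
  rewrite [X in (X * _)%E](slab_time_measure a00 ab0 b0T) [X in (_ * X)%E]EB.
  by rewrite -EFinM lte_fin mulr_gt0// subr_gt0.
have AF y : A y -> c < `|g y.1 (row_of_tuple y.2)|.
  case: y => t v [] /=; rewrite in_itv /B/= in_itv/= => tab vab.
  rewrite gF; last by lra.
  apply: rP; split => /=.
    rewrite /ball/= ltr_norml; move: tab; rewrite /a0 /b0 gt_max lt_min; lra.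
  split=> // i j; rewrite !ord1 /row_of_tuple mxE.
  by rewrite /ball/= ltr_norml; move: vab; rewrite /a1 /b1 gt_max lt_min; lra.
(* Positive total measure selects the essential supremum in the definition of the norm. *)
have muT : (0 < mu setT)%E.
  by apply: lt_le_trans muA _; apply: le_measure => //; rewrite inE.
move: Lc; rewrite /Linfty_cylinder unlock -/mu muT => /ess_supP.
move=> [N [mN N0 AN]].
have muAN : (mu A <= mu N)%E.
  apply: le_measure; rewrite ?inE// => y Ay; apply: AN => /=.
  by rewrite lee_fin leNgt AF.
by have := lt_le_trans muA muAN; rewrite [X in (_ < X)%E]N0 ltxx.
Qed.

(** * From functions of time and space to functions on space-time *)

Section Slices.
Context {R : realType} {d : nat}.
Implicit Types (G : R * 'rV[R]_d -> R) (t : R) (x : 'rV[R]_d).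

Lemma derive_slice_space G t x i :
  'D_(delta_mx 0 i) (fun y => G (t, y)) x = dder (dir_x i) G (t, x).
Proof.
rewrite -dderE /derive.
apply: (congr1 (fun q : R -> R => lim (q @ 0^'))); apply/funext => h.
have E : h *: dir_x i + (t, x) = (t, h *: delta_mx 0 i + x).
  by rewrite -[LHS]/(h * 0 + t, h *: delta_mx 0 i + x) mulr0 add0r.
by rewrite -[(G \o _) _]/(G (h *: dir_x i + (t, x))) E.
Qed.

Lemma derive_slice_time G t x :
  derive1 (fun s => G (s, x)) t = dder dir_t G (t, x).
Proof.
rewrite -dderE /derive1 /derive.
apply: (congr1 (fun q : R -> R => lim (q @ 0^'))); apply/funext => h.
have E : h *: dir_t + (t, x) = (h + t, x).
  by rewrite -[LHS]/(h * 1 + t, h *: 0 + x) mulr1 scaler0 add0r.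
by rewrite -[(G \o _) _]/(G (h *: dir_t + (t, x))) E.
Qed.

Lemma grad_slice G t : grad (fun x => G (t, x)) =
  fun x => \row_i dder (dir_x i) G (t, x).
Proof.
by apply/funext => x; apply/rowP => i; rewrite !mxE derive_slice_space.
Qed.

Lemma sqnorm_grad_slice G t x :
  sqnorm (grad (fun y => G (t, y)) x) = \sum_i dder (dir_x i) G (t, x) ^+ 2.
Proof.
by rewrite grad_slice /sqnorm; apply: eq_bigr => i _; rewrite mxE.
Qed.

Lemma laplacian_slice G t x :
  laplacian (fun y => G (t, y)) x = lap_x G (t, x).
Proof.
rewrite /laplacian grad_slice; apply: eq_bigr => i _.
by under [X in derive X]eq_fun do rewrite mxE; exact: derive_slice_space.
Qed.

Lemma divergence_slice G (H : R * 'rV[R]_d -> R) t x : smooth G -> smooth H ->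
  divergence (fun y => G (t, y) *: grad (fun y => H (t, y)) y) x =
  \sum_i (dder (dir_x i) G (t, x) * dder (dir_x i) H (t, x)
          + G (t, x) * dder (dir_x i) (dder (dir_x i) H) (t, x)).
Proof.
move=> sG sH; apply: eq_bigr => i _.
have E : (fun y => (G (t, y) *: grad (fun y => H (t, y)) y) 0 i) =
    fun y => (fun z => G z * dder (dir_x i) H z) (t, y).
  by apply/funext => y; rewrite grad_slice !mxE.
apply: etrans (congr1 (fun f => 'D_(delta_mx 0 i) f x) E) _.
rewrite (derive_slice_space
  (fun z => G z * dder (dir_x i) H z) t x i); apply: dder_val.
exact: (is_derive_mul (smooth_is_dder _ _ sG)
  (smooth_is_dder _ _ (smooth_dder _ sH))).
Qed.

(** [W] is given in advance rather than produced together with [U] and [M], so constants extracted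
    from it do not depend on the solution. *)
Lemma planning_extended_solution (T alpha : R) V m0 mT u m W :
  0 < T -> smooth W -> (forall t x, 0 <= t <= T -> V t x = W (t, x)) ->
  planning_solution T alpha V m0 mT u m ->
  exists U M, extended_solution T alpha U M W /\
    forall t x, 0 <= t <= T -> m t x = M (t, x).
Proof.
move=> T0 sW VW sol.
have [gu [sU _ uU]] := ps_u_smooth sol; have [gm [sM pM mM]] := ps_m_smooth sol.
pose U (z : R * 'rV[R]_d) := gu z.1 z.2; pose M (z : R * 'rV[R]_d) := gm z.1 z.2.
have mE t : 0 <= t <= T -> m t = fun x => M (t, x).
  by move=> tT; apply/funext => x; exact: mM.
have uE t : 0 <= t <= T -> u t = fun x => U (t, x).
  by move=> tT; apply/funext => x; exact: uU.
have near_T t : 0 < t < T -> \forall s \near t, 0 <= s <= T.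
  move=> /andP[t0 tT]; near=> s; apply/andP; split; apply/ltW; near: s.
    exact: lt_nbhsr.
  exact: lt_nbhsl.
exists U, M; split=> //; split=> //.
- by move=> [t x] /= tT; rewrite -[M _]mM// (ps_m_ge0 sol).
- move=> [t x] /= tT; have tT' : 0 <= t <= T by lra.
  rewrite -[M _]mM// -(ps_hamilton_jacobi sol)// uE// sqnorm_grad_slice VW//.
  congr (- _ + _ + _); rewrite -derive_slice_time !derive1E.
  (* [u] and its extension agree at all times close to an interior [t], which determines the time
     derivative. *)
  apply: near_eq_derive; near=> s; apply/esym/uU; near: s; exact: near_T.
- move=> [t x] /= tT; have tT' : 0 <= t <= T by lra.
  have := ps_continuity sol x tT; rewrite mE// uE// divergence_slice//.
  rewrite /continuity_eq => /subr0_eq <-.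
  rewrite -derive_slice_time !derive1E.
  apply: near_eq_derive; near=> s; apply/esym/mM; near: s; exact: near_T.
Unshelve. all: by end_near. Qed.

End Slices.

(** * Constants from the data, and the two bounds *)

Lemma smooth_torus_ubound (R : realType) (d : nat) (f : 'rV[R]_d -> R) :
  smooth_torus f -> exists C, forall x, f x <= C.
Proof.
move=> [sf pf].
have cF : continuous (fun z : R * 'rV[R]_d => f z.2).
  move=> z; apply: (@cvg_comp _ _ _ snd f _ (nbhs z.2)); first exact: cvg_snd.
  exact: (smooth_continuous sf).
(* A cylinder over the single time [0] reduces the claim to the space-time case. *)
have [z0 [_ _ Fmax]] := cylinder_max (lexx (0 : R)) cF (fun=> pf).
by exists (f z0.2) => x; apply: (Fmax (0, x)); rewrite /= lexx.
Qed.

Theorem theorem1p3 (R : realType) (d : nat) (T alpha : R)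
    (V : R -> 'rV[R]_d -> R) (m0 mT : 'rV[R]_d -> R)
    (d_ge1 : (1 <= d)%N) (data : planning_data T alpha V m0 mT) :
  (forall p : R, 0 < p ->
    (Linfty_cylinder T (fun t x => (laplacian (V t) x)%:E)
       < (2 / T ^+ 2 * (1 / p))%:E)%E ->
    exists2 C : R, 0 < C &
      forall u m : R -> 'rV[R]_d -> R,
        planning_solution T alpha V m0 mT u m ->
        forall t : R, 0 <= t <= T ->
          (Linfty_torus (fun x => (m t x)%:E) <= C%:E)%E)
  /\
  (d = 1%N ->
   forall p : R, 2 <= p -> alpha + 1 < p ->
    (Linfty_cylinder T (fun t x => (laplacian (V t) x)%:E)
       < (2 / T ^+ 2 * (1 / p))%:E)%E ->
    forall k0 : R, 0 < k0 ->
    (forall x, k0 <= m0 x) -> (forall x, k0 <= mT x) ->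
    exists2 C : R, 0 < C &
      forall u m : R -> 'rV[R]_d -> R,
        planning_solution T alpha V m0 mT u m ->
        forall t : R, 0 <= t <= T ->
          (Linfty_torus (fun x => (m t x)%:E^-1) <= C%:E)%E).
Proof.
have [T0 a0 [gV [sW _ VW]] sm0 smT m0d mTd] := data.
pose W (z : R * 'rV[R]_d) := gV z.1 z.2; rewrite -/W in sW.
have T01 : (0 : R) <= 0 <= T by rewrite lexx ltW.
have TT1 : 0 <= T <= T by rewrite lexx ltW.
split=> [p _ _|d1 p p2 _ VL k0 k00 m0k mTk].
  have [K [K0 WK]] := cylinder_cell_bounded (ltW T0) (smooth_lapx_continuous sW).
  have [C1 m0C] := smooth_torus_ubound sm0; have [C2 mTC] := smooth_torus_ubound smT.
  pose C0 := Num.max C1 C2.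
  have C00 : 0 <= C0 by rewrite le_max (le_trans (m0d.1 0) (m0C 0)).
  (* [K + 1] turns the bound on the Laplacian of [W] into the strict one required by
     [density_upper_bound]. *)
  pose C := C0 * expR ((K + 1) / 2 * T ^+ 2).
  have C_ge0 : 0 <= C by rewrite mulr_ge0// expR_ge0.
  exists (C + 1) => [|u m sol t tT]; first exact: ltr_wpDl.
  have [U [M [es mM]]] := planning_extended_solution T0 sW VW sol.
  apply: Linfty_torus_le => [|x]; first exact: addr_ge0.
  rewrite lee_fin ger0_norm ?(ps_m_ge0 sol)// mM// (@le_trans _ _ C) ?lerDl//.
  apply: (density_upper_bound T0 a0 es) => //; first exact: addr_ge0.
  - move=> z zT zbox; have := WK z zT zbox.
    by rewrite ler_norml; lra.
  - by move=> y; rewrite -mM// (ps_initial sol) le_max m0C.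
  - by move=> y; rewrite -mM// (ps_terminal sol) le_max mTC orbT.
subst d; pose c := 2 / T ^+ 2 * (1 / p).
have T2 : 0 < T ^+ 2 by rewrite exprn_gt0.
have p0 : 0 < p by lra.
(* This is where [2 <= p] enters. *)
have cT : c * T ^+ 2 <= 1.
  have -> : c * T ^+ 2 = 2 / p by rewrite /c; field; rewrite !gt_eqF.
  by rewrite ler_pdivrMr// mul1r.
have Wc (z : R * 'rV[R]_1) : 0 < z.1 < T -> (forall i, 0 <= z.2 0 i <= 1) -> lap_x W z <= c.
  move=> zT zbox; apply: le_trans (ler_norm _) _.
  apply: (Linfty_cylinder_bound (smooth_lapx_continuous sW) _ (ltW VL)) => //.
  move=> t x tT; rewrite -laplacian_slice.
  have -> : V t = fun y => W (t, y) by apply/funext => y; exact: VW.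
  by [].
exists ((k0 * (4 / 5))^-1) => [|u m sol t tT]; first by rewrite invr_gt0 mulr_gt0.
have [U [M [es mM]]] := planning_extended_solution T0 sW VW sol.
have Mk x : k0 * (4 / 5) <= m t x.
  rewrite mM//; apply: (density_lower_bound T0 a0 es cT k00 Wc) => // y.
    by rewrite -mM// (ps_initial sol).
  by rewrite -mM// (ps_terminal sol).
have k1 : 0 < k0 * (4 / 5) by rewrite mulr_gt0.
apply: Linfty_torus_le => [|x]; first by rewrite invr_ge0 ltW.
have mx0 := lt_le_trans k1 (Mk x).
(* The extended reciprocal is [+oo] at [0]; positivity of [m t x] makes it the real inverse. *)
rewrite inver gt_eqF// lee_fin ger0_norm ?invr_ge0 ?(ltW mx0)//.
by rewrite lef_pV2.
Qed.
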